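(* There exists a Banach space $\mathcal{X}$ such that, given any approximate Bessel sequence $(\{f_n\}_n,\{\tau_n\}_n)$ for $\mathcal{X}$, the pair $(\{f_n\}_n,\{\tau_n\}_n)$ cannot be expanded to an approximate Schauder frame (ASF) for $\mathcal{X}$.
   Context: Banach spaces are over $\mathbb{K}$, where $\mathbb{K}$ is $\mathbb{R}$ or $\mathbb{C}$; $\mathcal{X}^*$ is the continuous dual of $\mathcal{X}$, and sequences are indexed by $n\in\mathbb{N}=\{1,2,\dots\}$. Let $\{\tau_n\}_n$ be a sequence in $\mathcal{X}$ and $\{f_n\}_n$ a sequence in $\mathcal{X}^*$. The pair $(\{f_n\}_n,\{\tau_n\}_n)$ is an approximate Bessel sequence for $\mathcal{X}$ if $S_{f,\tau}:\mathcal{X}\to\mathcal{X}$, $S_{f,\tau}x := \sum_{n=1}^\infty f_n(x)\tau_n$, is a well-defined (the series converges in norm for every $x$) bounded linear operator. It is an approximate Schauder frame (ASF) for $\mathcal{X}$ if $S_{f,\tau}$ (called the frame operator) is a well-defined bounded linear invertible operator. The pair $(\{f_n\}_n,\{\tau_n\}_n)$ can be expanded to an ASF for $\mathcal{X}$ if there exist a sequence $\{g_n\}_n$ in $\mathcal{X}^*$ and a sequence $\{\omega_n\}_n$ in $\mathcal{X}$ such that $(\{f_n\}_n\cup\{g_n\}_n,\{\tau_n\}_n\cup\{\omega_n\}_n)$ is an ASF for $\mathcal{X}$, where the frame operator of this pair is $x\mapsto \sum_{n=1}^\infty f_n(x)\tau_n+\sum_{n=1}^\infty g_n(x)\omega_n$;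 that is, this map is a well-defined bounded linear invertible operator on $\mathcal{X}$. *)

(* Defs.v *)
From HB Require Import structures.
From mathcomp Require Import all_boot all_order all_algebra complex.
From mathcomp Require Import boolp classical_sets reals topology normedtype.
From mathcomp Require Import sequences.

Set Implicit Arguments.
Unset Strict Implicit.
Unset Printing Implicit Defensive.

Import Order.TTheory GRing.Theory Num.Theory.
Import numFieldNormedType.Exports.

Local Open Scope classical_set_scope.
Local Open Scope ring_scope.

Record dual (K : numFieldType) (X : normedModType K) := Dual {
  dual_fun :> {linear X -> K^o};
  dual_continuous : continuous dual_fun }.

Section OperatorDefs.
Context (K : numFieldType) (X : normedModType K).

(* Norms take values in [K] itself, hence so does the bound [M]. *)
Definition bounded_linear_op (S : X -> X) : Prop :=
  linear S /\ exists M : K, forall x : X, `|S x| <= M * `|x|.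

Definition bounded_linear_invertible_op (S : X -> X) : Prop :=
  bounded_linear_op S /\
  exists T : X -> X, [/\ bounded_linear_op T, cancel S T & cancel T S].

End OperatorDefs.

Section FrameDefs.
Context (K : numFieldType) (X : completeNormedModType K).
Implicit Types (f g : nat -> dual X) (tau omega : nat -> X).

(* Sequences are indexed from 0 instead of 1. *)
Definition frame_series f tau (x : X) : nat -> X :=
  series (fun n => f n x *: tau n).

Definition frame_series_cvg f tau : Prop :=
  forall x : X, cvgn (frame_series f tau x).

(* [limn] is total: this is the sum of the series only under
   [frame_series_cvg]. *)
Definition frame_operator f tau (x : X) : X := limn (frame_series f tau x).

Definition approximate_Bessel f tau : Prop :=
  frame_series_cvg f tau /\ bounded_linear_op (frame_operator f tau).

Definition union_ASF f tau g omega : Prop :=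
  [/\ frame_series_cvg f tau, frame_series_cvg g omega &
      bounded_linear_invertible_op
        (fun x => frame_operator f tau x + frame_operator g omega x)].

Definition expandable_to_ASF f tau : Prop :=
  exists g omega, union_ASF f tau g omega.

End FrameDefs.

(* Main.v *)
(** If a pair expands to an approximate Schauder frame, its frame operator is
    injective, so a vector x is determined by the coefficients
    (f_n(x), g_n(x))_n and the space embeds into I = (K * K)^N. The Banach space
    of bounded functions on the set I contains the indicator functions of all
    subsets of I, so by Cantor's theorem it does not embed into I. *)
Require Import Defs.
From HB Require Import structures.
From mathcomp Require Import all_boot all_order all_algebra complex.
From mathcomp Require Import boolp classical_sets functions reals topology.
From mathcomp Require Import normedtype sequences.

Set Implicit Arguments.
Unset Strict Implicit.
Unset Printing Implicit Defensive.

Import Order.TTheory GRing.Theory Num.Theory.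
Import numFieldNormedType.Exports.

Local Open Scope classical_set_scope.
Local Open Scope ring_scope.

(** * Injectivity of the coefficient map and Cantor's theorem *)

Lemma union_ASF_coef_inj (K : numFieldType) (X : completeNormedModType K)
    (f g : nat -> dual X) (tau omega : nat -> X) :
  union_ASF f tau g omega ->
  injective (fun (x : X) (n : nat) => (f n x : K, g n x : K)).
Proof.
case=> _ _ [_ [T [_ SK _]]] x y fgxy; apply: (can_inj SK).
have fxy n : f n x = f n y by have := congr1 (fun c => (c n).1) fgxy.
have gxy n : g n x = g n y by have := congr1 (fun c => (c n).2) fgxy.
rewrite /frame_operator /frame_series.
by congr (lim (series _ @ \oo) + lim (series _ @ \oo));
  apply/funext => n; rewrite ?fxy ?gxy.
Qed.

Lemma Cantor_set_inj (T : Type) (h : set T -> T) : ~ injective h.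
Proof.
(* Diagonal set: [A] collects the codes [h B] of the sets [B] that miss their own code. By
   injectivity, [h A] in [A] would force [h A] not in [A]; hence [h A] is not in [A], and this puts
   it in [A]. *)
move=> hI; pose A := [set t | exists2 B, h B = t & ~ B t].
have nA : ~ A (h A) by move=> AhA; case: (AhA) => B /hI ->; apply.
exact: (nA (ex_intro2 _ _ A erefl nA)).
Qed.

(** The subsets are those of the coefficient type itself, so [e] followed by the coefficient map is
    exactly the kind of injection that Cantor's theorem forbids. *)
Lemma no_expandable_of_large (K : numFieldType) (X : completeNormedModType K)
    (e : set (nat -> K * K) -> X) : injective e ->
  forall (f : nat -> dual X) (tau : nat -> X), ~ expandable_to_ASF f tau.
Proof.
move=> eI f tau [g [omega /union_ASF_coef_inj coefI]].
exact: (Cantor_set_inj (inj_comp coefI eI)).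
Qed.

(** * The Banach space of bounded functions with the supremum norm *)

Section BoundedFunctions.
Context (T : Type) (K : numFieldType).

Definition bounded_pred : {pred T -> K^o} :=
  fun x => `[< exists M : K, forall t, `|x t| <= M >].

Lemma bounded_predP (x : T -> K^o) :
  reflect (exists M : K, forall t, `|x t| <= M) (x \in bounded_pred).
Proof. exact: asboolP. Qed.

Lemma bounded_pred_submod_closed : submod_closed bounded_pred.
Proof.
split=> [|a x y /bounded_predP[M xM] /bounded_predP[N yN]].
  by apply/bounded_predP; exists 0 => t; rewrite normr0.
apply/bounded_predP; exists (`|a| * M + N) => t.
by rewrite (le_trans (ler_normD _ _))// lerD// normrM ler_wpM2l.
Qed.

HB.instance Definition _ :=
  GRing.isSubmodClosed.Build K (T -> K^o) bounded_pred
    bounded_pred_submod_closed.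

Record bounded_fun := BoundedFun {
  bounded_val :> T -> K^o; _ : bounded_val \in bounded_pred }.

HB.instance Definition _ := [isSub for bounded_val].
HB.instance Definition _ := [Choice of bounded_fun by <:].
HB.instance Definition _ := [SubChoice_isSubLmodule of bounded_fun by <:].

(* Both hypotheses hold for [R] and [R[i]]. The order of [R[i]] is partial: an
   upper bound of nonnegative elements is a nonnegative real. *)
Hypothesis nneg_lub : forall A : set K, A !=set0 -> (forall a, A a -> 0 <= a) ->
  ubound A !=set0 -> supremums A !=set0.
Hypothesis K_complete : forall F : set_system K^o,
  ProperFilter F -> cauchy_ex F -> cvg F.

Implicit Types x y : bounded_fun.

(** The default [0] is the norm when [T] is empty. *)
Definition sup_norm x : K := supremum 0 [set `|x t| | t in [set: T]].

Lemma supremums_sup_norm x (t : T) :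
  supremums [set `|x u| | u in [set: T]] (sup_norm x).
Proof.
have /bounded_predP[M xM] := valP x.
have A0 : [set `|x u| | u in [set: T]] !=set0 by exists `|x t|, t.
rewrite /sup_norm /supremum ifN; last exact/set0P.
apply: xgetPex; apply: nneg_lub => [//|_ [u _ <-] //|].
by exists M => _ [u _ <-].
Qed.

Lemma ler_sup_norm x t : `|x t| <= sup_norm x.
Proof. by have [+ _] := supremums_sup_norm x t; apply; exists t. Qed.

(** For empty [T] the norm is the default [0], and [0 <= M] gives the bound; otherwise the norm is a
    least upper bound. *)
Lemma sup_norm_le x M : 0 <= M -> (forall t, `|x t| <= M) -> sup_norm x <= M.
Proof.
move=> M0 xM.
have [A0|/set0P[_ [t _ _]]] := eqVneq [set `|x t| | t in [set: T]] set0.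
  by rewrite /sup_norm A0 supremum0.
by have [_] := supremums_sup_norm x t; apply => _ [u _ <-].
Qed.

Lemma sup_norm_ge0 x : 0 <= sup_norm x.
Proof.
have [A0|/set0P[_ [t _ _]]] := eqVneq [set `|x t| | t in [set: T]] set0.
  by rewrite /sup_norm A0 supremum0.
exact: le_trans (ler_sup_norm x t).
Qed.

Lemma ler_sup_normD x y : sup_norm (x + y) <= sup_norm x + sup_norm y.
Proof.
apply: sup_norm_le => [|t]; first by rewrite addr_ge0 ?sup_norm_ge0.
by rewrite (le_trans (ler_normD _ _))// lerD ?ler_sup_norm.
Qed.

Lemma sup_normZ (a : K) x : sup_norm (a *: x) = `|a| * sup_norm x.
Proof.
have le_Z b y : sup_norm (b *: y) <= `|b| * sup_norm y.
  apply: sup_norm_le => [|t]; first by rewrite mulr_ge0 ?sup_norm_ge0.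
  by rewrite [_ t]/= normrM ler_wpM2l ?ler_sup_norm.
(* The reverse inequality is [le_Z] again, for the scalar inverse to [a] and the vector [a *: x]. *)
apply/le_anti; rewrite le_Z/=.
have [->|a0] := eqVneq a 0; first by rewrite normr0 mul0r sup_norm_ge0.
rewrite -ler_pdivlMl ?normr_gt0// -normfV.
by rewrite -{1}[x](scalerK a0) le_Z.
Qed.

Lemma sup_norm_eq0 x : sup_norm x = 0 -> x = 0.
Proof.
move=> x0; apply/val_inj/funext => t; apply/normr0_eq0/le_anti.
by rewrite normr_ge0 -x0 ler_sup_norm.
Qed.

(** The norm axioms rest on [nneg_lub], so the structure is packed as a term under that
    hypothesis. *)
Let bounded_normed : normedModType K := HB.pack bounded_fun
  (Lmodule_isNormed.Build K bounded_fun ler_sup_normD sup_normZ sup_norm_eq0).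

Lemma bounded_fun_complete (F : set_system bounded_normed) :
  ProperFilter F -> cauchy F -> cvg F.
Proof.
move=> FF /cauchyP Fcauchy.
have ler_norm_eval (x y : bounded_normed) t : `|x t - y t| <= `|x - y|.
  exact: (ler_sup_norm (x - y)).
have cvg_eval t : cvg ((fun x : bounded_normed => x t : K^o) @ F).
  apply: K_complete => e e0; have [x Fx] := Fcauchy e e0.
  exists (x t); change (F (bounded_val^~ t @^-1` ball (x t) e)).
  apply: filterS Fx => y; rewrite -!ball_normE /=.
  exact: le_lt_trans (ler_norm_eval x y t).
(* The candidate limit is the pointwise one. *)
pose l t : K^o := lim ((fun x : bounded_normed => x t : K^o) @ F).
rewrite /cauchy_ex -ball_normE in Fcauchy.
(* An intermediate [y] is chosen within [e] of [x] in norm and within [e] of the limit at the point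
   [t]. It may depend on [t], but the bound [e + e] does not, so the estimate is uniform. *)
have ball_l (e : K) (x : bounded_normed) : 0 < e ->
    F (ball_ Num.norm x e) -> forall t, `|l t - x t| <= e + e.
  move=> e0 Fx t.
  have /cvgrPdist_lt/(_ e e0) l_eval :
    (fun y : bounded_normed => y t : K^o) @ F --> l t := cvg_eval t.
  near F => y.
  rewrite -(subrKA (y t)) (le_trans (ler_normD _ _))// lerD//.
    by apply: ltW; near: y; exact: l_eval.
  rewrite distrC (le_trans (ler_norm_eval _ _ _))// ltW//.
  by near: y.
have l_bounded : l \in bounded_pred.
  have [x Fx] := Fcauchy 1 ltr01; apply/bounded_predP.
  exists (1 + 1 + sup_norm x) => t; rewrite -[l t](subrK (x t)).
  by rewrite (le_trans (ler_normD _ _))// lerD ?ball_l ?ler_sup_norm.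
pose L : bounded_normed := BoundedFun l_bounded.
apply/cvg_ex; exists L; apply/cvgrPdist_le => e e0.
(* With radius a quarter of [e], passing from [l] to [x] costs two quarters by [ball_l], and passing
   from [x] to [y] costs at most the other two. *)
have e4_gt0 : 0 < e / 2 / 2 by rewrite !divr_gt0.
have [x Fx] := Fcauchy _ e4_gt0.
apply: filterS (Fx) => y /= xy.
apply: sup_norm_le => [|t]; first exact: ltW.
have -> : e = e / 2 / 2 + e / 2 / 2 + (e / 2 / 2 + e / 2 / 2).
  by rewrite -!splitr.
change (`|l t - y t| <= e / 2 / 2 + e / 2 / 2 + (e / 2 / 2 + e / 2 / 2)).
rewrite -(subrKA (x t)) (le_trans (ler_normD _ _))// lerD ?ball_l//.
apply: le_trans (ler_norm_eval x y t) _.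
by rewrite (le_trans (ltW xy))// lerDl ltW.
Unshelve. all: by end_near. Qed.

Definition bounded_Banach : completeNormedModType K :=
  HB.pack (bounded_normed : Type) (NormedModule.on bounded_normed)
    (Uniform_isComplete.Build bounded_normed bounded_fun_complete).

End BoundedFunctions.

(** * Least upper bounds and completeness for real and complex scalars *)

Lemma R_nneg_lub (R : realType) (A : set R) :
  A !=set0 -> (forall a, A a -> 0 <= a) -> ubound A !=set0 ->
  supremums A !=set0.
Proof.
move=> A0 _ ubA; exists (sup A); split; first exact/ubP/sup_upper_bound.
by move=> M AM; exact: ge_sup.
Qed.

Section Complex.
Context (R : realType).
Local Notation re := (@complex.Re R).
Local Notation im := (@complex.Im R).

(** Nonnegative complex numbers are real, so the supremum of the real parts serves. *)
Lemma complex_nneg_lub (A : set R[i]) :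
  A !=set0 -> (forall a, A a -> 0 <= a) -> ubound A !=set0 ->
  supremums A !=set0.
Proof.
move=> [a0 Aa0] A_ge0 [M AM].
have AE a : A a -> a = (re a)%:C%C by move=> /A_ge0 /ger0_real /RRe_real.
have ubRe z : ubound A z -> ubound (re @` A) (re z).
  by move=> Az _ [a /Az + <-]; rewrite lecE => /andP[].
have supA : has_sup (re @` A).
  by split; [exists (re a0), a0|exists (re M); exact: ubRe].
exists (sup (re @` A))%:C%C; split=> [a Aa|z Az].
  by rewrite [a]AE// lecR; apply: sup_upper_bound => //; exists a.
(* An upper bound lies above the nonnegative [a0], hence is real and can be compared through its
   real part. *)
have z_real : z \is Num.real.
  by rewrite ger0_real// (le_trans (A_ge0 _ Aa0))// Az.
rewrite -(RRe_real z_real) lecR.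
by apply: ge_sup; [case: supA|exact: ubRe].
Qed.

Lemma normc_real (a : R) : `|a%:C%C| = `|a|%:C%C :> R[i].
Proof. by rewrite normc_def/= expr0n addr0 sqrtr_sqr. Qed.

Lemma normc_i : `|'i%C| = 1 :> R[i].
Proof. by rewrite normc_def/= expr0n add0r expr1n sqrtr1. Qed.

(** Multiplication by ['i] preserves the norm and turns the imaginary part, up to sign, into a real
    part. *)
Lemma normc_ge_Im (z : R[i]) : `|im z|%:C%C <= `|z|.
Proof.
by rewrite -normrN -ReiNIm (le_trans (normc_ge_Re _))// normrM normc_i mulr1.
Qed.

Lemma normc_le_ReD_Im (z : R[i]) : `|z| <= (`|re z| + `|im z|)%:C%C.
Proof.
rewrite {1}[z]complexE (le_trans (ler_normD _ _))// normrM !normc_real normc_i.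
by rewrite mul1r raddfD.
Qed.

(** Real and imaginary parts respect differences and do not increase norms, so they carry a Cauchy
    filter to Cauchy filters on [R], whose limits are recombined. *)
Lemma complex_complete (F : set_system R[i]^o) :
  ProperFilter F -> cauchy_ex F -> cvg F.
Proof.
move=> FF Fcauchy.
have cvg_part (p : R[i] -> R) : {morph p : x y / x - y} ->
    (forall z, `|p z|%:C%C <= `|z|) -> cvg (p @ F).
  move=> pB p_le; apply/cauchy_cvgP/cauchy_exP => e e0.
  have e0' : 0 < e%:C%C by rewrite ltcR.
  have [z Fz] := Fcauchy _ e0'.
  exists (p z); change (F (p @^-1` ball (p z) e)).
  apply: filterS Fz => y; rewrite -!ball_normE/= -ltcR -pB.
  exact: le_lt_trans.
have cvg_re : cvg (re @ F) by apply: cvg_part (@normc_ge_Re R) => -[? ?] [].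
have cvg_im : cvg (im @ F) by apply: cvg_part normc_ge_Im => -[? ?] [].
apply/cvg_ex; exists (lim (re @ F) +i* lim (im @ F))%C.
apply/cvgrPdist_le => e e0.
(* Positivity in the partial order of [R[i]] makes [e] real, so the final estimate takes place in
   [R]. *)
have eE : e = (re e)%:C%C by rewrite RRe_real// gtr0_real.
have e2_gt0 : 0 < re e / 2 by rewrite divr_gt0// -ltcR -eE.
move/cvgrPdist_le/(_ _ e2_gt0) : cvg_re.
move/cvgrPdist_le/(_ _ e2_gt0) : cvg_im.
apply: filterS2 => -[a b] /= le_im le_re.
rewrite (le_trans (normc_le_ReD_Im _))// eE lecR [leRHS]splitr.
exact: lerD.
Qed.

End Complex.

(** * Indicator functions and the conclusion for both scalar fields *)

Lemma large_Banach_space (K : numFieldType) :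
  (forall A : set K, A !=set0 -> (forall a, A a -> 0 <= a) ->
    ubound A !=set0 -> supremums A !=set0) ->
  (forall F : set_system K^o, ProperFilter F -> cauchy_ex F -> cvg F) ->
  forall T : Type, exists (X : completeNormedModType K) (e : set T -> X),
    injective e.
Proof.
move=> nneg_lub K_complete T.
pose ind (A : set T) (t : T) : K^o := (t \in A)%:R.
have ind_bounded A : ind A \in @bounded_pred T K.
  apply/bounded_predP; exists 1 => t.
  by rewrite /ind; case: (t \in A); rewrite ?normr1 ?normr0.
exists (bounded_Banach T nneg_lub K_complete).
exists (fun A => BoundedFun (ind_bounded A)) => A B.
move=> /(congr1 (@bounded_val T K))/= indAB; apply/predeqP => t.
have : (t \in A)%:R = (t \in B)%:R :> K := congr1 (@^~ t) indAB.
rewrite -[A t]in_setE -[B t]in_setE.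
by do 2 case: (t \in _) => //=; move/eqP; rewrite ?(eq_sym 0) oner_eq0.
Qed.

Theorem corollary2p6 (R : realType) :
  (exists X : completeNormedModType R,
     forall (f : nat -> dual X) (tau : nat -> X),
       approximate_Bessel f tau -> ~ expandable_to_ASF f tau) /\
  (exists X : completeNormedModType (complex R),
     forall (f : nat -> dual X) (tau : nat -> X),
       approximate_Bessel f tau -> ~ expandable_to_ASF f tau).
Proof.
have R_cvg (F : set_system R^o) : ProperFilter F -> cauchy_ex F -> cvg F.
  by move=> FF /cauchy_exP; exact: R_complete.
(* The index set is the type of coefficient families; it depends only on the scalars, so one space
   serves all pairs. *)
have [X [e eI]] := large_Banach_space (@R_nneg_lub R) R_cvg (nat -> R * R).
have [Y [d dI]] := large_Banach_space (@complex_nneg_lub R)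
  (@complex_complete R) (nat -> R[i] * R[i]).
by split; [exists X => f tau _; exact: no_expandable_of_large eI f tau
          |exists Y => f tau _; exact: no_expandable_of_large dI f tau].
Qed.
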